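(* Assume that (i) for every $j\in\{1,\dots,K\}$ and all $1\le \tau\le\tau'$, $\max_i p_{ji}^{(\tau)}\ge \max_i p_{ji}^{(\tau')}$, and (ii) $R^1<\infty$ and $R^1\ge R(\vec\pi_j^{\tau},0)\ge R(\vec\pi_j^{\tau'},0)$ for all $j$ and all $1\le\tau\le\tau'$. Then the user (bandit) is indexable: one can choose for every $W\in\mathbb{R}$ a threshold policy $\vec\Gamma(W)$ that is optimal for the single-user average-reward problem with subsidy $W$, in such a way that the passive sets $$\mathcal{L}(W)=\{\vec\pi_j^\tau\in\Pi:\ j\in\{1,\dots,K\},\ \tau\ge1,\ \tau\le\Gamma_j(W)\}$$ satisfy $\mathcal{L}(W)\subseteq\mathcal{L}(W')$ for all $W<W'$. (This holds for every user, i.e. for every choice of a stochastic matrix $P=(p_{ij})_{i,j\in\{1,\dots,K\}}$ with steady-state distribution $(p_1^s,\dots,p_K^s)$, an active reward $R^1$ and nonnegative passive rewards $R(\vec\pi_j^\tau,0)$, $j\in\{1,\dots,K\}$, $\tau\ge1$, that satisfy conditions (i) and (ii).)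
   Context: Single-user model. Let $K\ge1$ and let $P=(p_{ij})_{i,j\in\{1,\dots,K\}}$ be a stochastic matrix, with $\tau$-step probabilities $p_{ij}^{(\tau)}=(P^\tau)_{ij}$ and steady-state distribution $(p_1^s,\dots,p_K^s)$ (assumed to exist). For $j\in\{1,\dots,K\}$ and integer $\tau\ge1$ the belief state $\vec\pi_j^\tau=\vec e_jP^\tau$ means that the user was last observed $\tau$ slots ago in channel state $j$; belief states are labelled by the pairs $(j,\tau)$, and $\Pi$ is the set of all of them. In each slot an action $a\in\{0,1\}$ is chosen ($a=1$ active, $a=0$ passive). The average immediate reward is $R^1$ under $a=1$ and $R(\vec\pi_j^\tau,0)\ge0$ under $a=0$ in $\vec\pi_j^\tau$. Approximating transition law: under $a=0$, $\vec\pi_j^\tau$ moves to $\vec\pi_j^{\tau+1}$ with probability 1; under $a=1$, $\vec\pi_j^\tau$ moves to $\vec\pi_k^1$ with probability $p_k^s$, $k=1,\dots,K$. Single-user average-reward problem with subsidy $W$: maximize the long-run expected average ($\liminf_{T\to\infty}\frac1T\mathbb{E}\sum_{t=1}^T$) of the immediate reward plus $W$ for each passive slot. Threshold policy $\vec\Gamma=(\Gamma_1,\dots,\Gamma_K)$, $\Gamma_j\in\{0,1,\dots\}\cup\{\infty\}$: choose $a=0$ in $\vec\pi_j^\tau$ if $\tau\le\Gamma_j$ and $a=1$ if $\tau>\Gamma_j$. Optimal means optimal for every initial belief state. *)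

(* Defs.v *)
From HB Require Import structures.
From mathcomp Require Import all_boot all_order all_algebra.
From mathcomp Require Import all_classical all_reals all_analysis.

Set Implicit Arguments.
Unset Strict Implicit.
Unset Printing Implicit Defensive.
Import Order.TTheory GRing.Theory Num.Theory.
Local Open Scope classical_set_scope.
Local Open Scope ring_scope.

Definition stochastic (R : realType) (K : nat) (P : 'M[R]_K) : Prop :=
  (forall i j, 0 <= P i j) /\ (forall i, \sum_(j < K) P i j = 1).

(* Steady state is read as invariance under P.  A limit of the rows of P ^+ t
   satisfies this, so both usual meanings of the term are covered. *)
Definition steady_state (R : realType) (K : nat) (P : 'M[R]_K)
    (ps : 'rV[R]_K) : Prop :=
  [/\ forall k, 0 <= ps ord0 k, \sum_(k < K) ps ord0 k = 1 & ps *m P = ps].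

(* max_i p_ji^(t); the default 0 is harmless since P ^+ t is nonnegative
   for stochastic P, and K > 0. *)
Definition max_prob (R : realType) (K : nat) (P : 'M[R]_K) (j : 'I_K)
    (t : nat) : R :=
  \big[Num.max/0]_(i < K) (P ^+ t) j i.

(* The pair (j, t) labels the belief state e_j P^t.  Only labels with t > 0
   belong to Pi; the transitions below never reach a label with t = 0 from
   one with t > 0. *)
Definition label (K : nat) : Type := ('I_K * nat)%type.

Definition belief_states (K : nat) : set (label K) := [set s | (0 < s.2)%N].

(* Actions are booleans: true is active, false is passive.  next_mean ps f s a
   is the expectation of f at the label that follows s under action a. *)
Definition next_mean (R : realType) (K : nat) (ps : 'rV[R]_K)
    (f : label K -> R) (s : label K) (a : bool) : R :=
  if a then \sum_(k < K) ps ord0 k * f (k, 1%N) else f (s.1, s.2.+1).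

Definition reward (R : realType) (K : nat) (R1 : R) (R0 : 'I_K -> nat -> R)
    (W : R) (s : label K) (a : bool) : R :=
  if a then R1 else R0 s.1 s.2 + W.

(* History-dependent randomized policies: pi h s is the probability of the
   active action at the current label s, where h lists, oldest first, the
   labels visited before and the actions chosen there. *)
Definition policy (R : realType) (K : nat) : Type :=
  seq (label K * bool) -> label K -> R.

Definition admissible (R : realType) (K : nat) (pi : policy R K) : Prop :=
  forall h s, 0 <= pi h s <= 1.

(* The expected total reward of the next T slots, given the past h and the
   current label s.  The controlled process branches finitely, so conditioning
   on the first action and the first transition defines this expectation. *)
Fixpoint total_reward (R : realType) (K : nat) (ps : 'rV[R]_K) (R1 : R)
    (R0 : 'I_K -> nat -> R) (W : R) (pi : policy R K) (T : nat)
    (h : seq (label K * bool)) (s : label K) {struct T} : R :=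
  if T is T'.+1 then
    let value a := reward R1 R0 W s a +
      next_mean ps (total_reward ps R1 R0 W pi T' (rcons h (s, a))) s a in
    pi h s * value true + (1 - pi h s) * value false
  else 0.

Definition average_reward (R : realType) (K : nat) (ps : 'rV[R]_K) (R1 : R)
    (R0 : 'I_K -> nat -> R) (W : R) (pi : policy R K) (s : label K) : \bar R :=
  limn_einf
    (fun T : nat => (T%:R^-1 * total_reward ps R1 R0 W pi T [::] s)%:E).

Definition optimal (R : realType) (K : nat) (ps : 'rV[R]_K) (R1 : R)
    (R0 : 'I_K -> nat -> R) (W : R) (pi : policy R K) : Prop :=
  admissible pi /\
  forall s, belief_states s -> forall pi' : policy R K, admissible pi' ->
    (average_reward ps R1 R0 W pi' s <= average_reward ps R1 R0 W pi s)%E.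

(* None is the infinite threshold. *)
Definition within_threshold (t : nat) (g : option nat) : bool :=
  if g is Some m then (t <= m)%N else true.

Definition threshold_policy (R : realType) (K : nat)
    (Gamma : 'I_K -> option nat) : policy R K :=
  fun _ s => if within_threshold s.2 (Gamma s.1) then 0 else 1.

Definition passive_set (K : nat) (Gamma : 'I_K -> option nat) :
    set (label K) :=
  [set s | belief_states s /\ within_threshold s.2 (Gamma s.1)].

(* Main.v *)
Require Import Defs.
From HB Require Import structures.
From mathcomp Require Import all_boot all_order all_algebra.
From mathcomp Require Import all_classical all_reals all_analysis.
From mathcomp Require Import lra.

Set Implicit Arguments.
Unset Strict Implicit.
Unset Printing Implicit Defensive.
Import Order.TTheory GRing.Theory Num.Theory.
Local Open Scope classical_set_scope.
Local Open Scope ring_scope.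

(** Fix the subsidy W and charge every slot a price x.  An active slot restarts
    the user in a label (k, 1) with k drawn from ps, whatever happened before,
    so the slots from one restart up to and including the next active slot form
    a cycle.  Passive rewards decrease with the age t, so against the price x
    the best plan for a cycle is to stay passive as long as R0 k t + W >= x,
    which earns

      R1 - x + sum_k ps_k sum_(t >= 1) max(0, R0 k t + W - x)

    net of the price.  The inner sum may diverge, so it is cut after n terms:
    this is cycle_surplus W x n, and gain W is the least price x at which
    cycle_surplus W x n <= 0 for every n.  The threshold policy is to be passive
    in (j, t) exactly when R0 j t >= gain W - W.

    - No policy does better.  Within T slots from (j, t) any policy, even one
      depending on the history, collects at most T * gain W plus the excess
      sum_(t <= u < t + T) max(0, R0 j u + W - gain W) of the passive run it
      starts in, by induction on T (total_reward_le).  Keeping the excess in the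
      bound matters: a starting label whose k has ps_k = 0 is never revisited,
      and staying passive there forever may beat gain W on average.
    - The threshold policy falls short of this bound by at most a constant
      (threshold_bounded_deficit).  If every k with ps_k > 0 has a finite
      threshold, minimality of gain W forces cycle_surplus W (gain W) n = 0 for
      large n, so restarts far from the horizon lose nothing.  If some k0 with ps_k0 > 0 is never
      activated, each restart loses at most gain W - R1 and leads with
      probability ps_k0 to a run that loses nothing more, so the expected loss
      is at most (gain W - R1) / ps_k0.
    - A bounded difference of total rewards vanishes in the average
      (average_reward_le), hence the threshold policy is optimal.
    - Raising W to W' raises gain by at most W' - W (gain_slope): a cycle cannot
      profit from a subsidy increase that the price absorbs, and the active slot
      only pays.  So gain W - W is nonincreasing and the passive sets grow. *)

(** * Long-run averages and bounded regret *)

Section Averages.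
Variable R : realType.

Lemma limn_einf_le_eps (u v : (\bar R)^nat) :
  (forall e : R, 0 < e -> \forall n \near \oo, (u n <= e%:E + v n)%E) ->
  (limn_einf u <= limn_einf v)%E.
Proof.
move=> uv; apply/lee_addgt0Pr => e e0.
rewrite addeC -limn_einf_shift// !limn_einf_lim.
apply: lee_lim; [exact: is_cvg_einfs|exact: is_cvg_einfs|].
have [N _ hN] := uv _ e0.
exists N => // n /= Nn; apply: le_ereal_inf_tmp => _ [m /= nm <-].
apply: le_trans (hN m (leq_trans Nn nm)).
by apply: ereal_inf_lbound; exists m.
Qed.

(** Dividing by the horizon T makes the constant C negligible. *)
Lemma average_reward_le (K : nat) (ps : 'rV[R]_K) (R1 : R)
    (R0 : 'I_K -> nat -> R) (W C : R) (pi pi' : policy R K) (s : label K) :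
  (forall T, total_reward ps R1 R0 W pi' T [::] s <=
             total_reward ps R1 R0 W pi T [::] s + C) ->
  (average_reward ps R1 R0 W pi' s <= average_reward ps R1 R0 W pi s)%E.
Proof.
move=> regret; apply: limn_einf_le_eps => e e0.
near=> T; rewrite -EFinD lee_fin.
have T0 : 0 < T%:R :> R by rewrite ltr0n; near: T; exists 1%N.
rewrite -(ler_pM2l T0) mulrDr !mulVKf ?gt_eqF// addrC.
apply: le_trans (regret T) _; rewrite lerD2l.
rewrite -ler_pdivrMr//; apply: ltW; near: T; exact: nbhs_infty_gtr.
Unshelve. all: by end_near. Qed.

End Averages.

(** * Excess rewards and the gain *)

Section Bandit.
Variables (R : realType) (K : nat) (ps : 'rV[R]_K).
Hypothesis ps_ge0 : forall k, 0 <= ps ord0 k.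
Hypothesis ps_sum : \sum_(k < K) ps ord0 k = 1.
Variables (R1 : R) (R0 : 'I_K -> nat -> R).
Hypothesis R0_le : forall j t, (0 < t)%N -> R0 j t <= R1.
Hypothesis R0_dec : forall j t t',
  (0 < t)%N -> (t <= t')%N -> R0 j t' <= R0 j t.

(** States of probability 0 are exempt from the comparison: nothing bounds the
    reward of a passive run in such a state. *)
Lemma mean_le (f g : 'I_K -> R) :
  (forall k, 0 < ps ord0 k -> f k <= g k) ->
  \sum_k ps ord0 k * f k <= \sum_k ps ord0 k * g k.
Proof.
move=> fg; apply: ler_sum => k _.
have := ps_ge0 k; rewrite le_eqVlt => /predU1P[<-|k0]; first by rewrite !mul0r.
by rewrite ler_pM2l // fg.
Qed.

Lemma mean_affine (a : R) (f : 'I_K -> R) :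
  \sum_k ps ord0 k * (a + f k) = a + \sum_k ps ord0 k * f k.
Proof.
by under eq_bigr do rewrite mulrDr; rewrite big_split /= -mulr_suml ps_sum mul1r.
Qed.

(** The price y is compared with the bare reward R0: for a price x per slot and
    a subsidy W it is x - W. *)
Definition excess (y : R) (k : 'I_K) (t n : nat) : R :=
  \sum_(t <= u < t + n) Num.max 0 (R0 k u - y).

Lemma excess_rec y k t n :
  excess y k t n.+1 = Num.max 0 (R0 k t - y) + excess y k t.+1 n.
Proof. by rewrite /excess big_ltn ?addSnnS // -addSnnS leq_addr. Qed.

Lemma excess_ge0 y k t n : 0 <= excess y k t n.
Proof. by apply: sumr_ge0 => u _; rewrite le_max lexx. Qed.

Lemma excess_eq0 y k t n : (0 < t)%N -> R0 k t <= y -> excess y k t n = 0.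
Proof.
move=> t0 ty; rewrite /excess big_nat big1 // => u /andP[tu _].
by apply/max_idPl; rewrite subr_le0 (le_trans (R0_dec _ t0 tu)).
Qed.

Lemma excess_split y k t m n :
  excess y k t (m + n) = excess y k t m + excess y k (t + m) n.
Proof. by rewrite /excess addnA (big_cat_nat (leq_addr m t) (leq_addr n (t + m))). Qed.

Lemma excess_lipschitz y y' k t n : y <= y' ->
  excess y k t n <= excess y' k t n + n%:R * (y' - y).
Proof.
move=> yy'; elim: n t => [|n IH] t.
  by rewrite /excess addn0 !big_geq // mul0r addr0.
rewrite !excess_rec -(addn1 n) natrD mulrDl mul1r.
have := IH t.+1; suff: Num.max 0 (R0 k t - y) <= Num.max 0 (R0 k t - y') + (y' - y).
  lra.
have h1 : R0 k t - y' <= Num.max 0 (R0 k t - y') by rewrite le_max lexx orbT.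
have h2 : 0 <= Num.max 0 (R0 k t - y') by rewrite le_max lexx.
by rewrite ge_max; apply/andP; split; lra.
Qed.

(** The largest expected net earning of a cycle against the price x per slot,
    among plans that stay passive for at most n slots. *)
Definition cycle_surplus (W x : R) (n : nat) : R :=
  R1 - x + \sum_k ps ord0 k * excess (x - W) k 1 n.

Lemma cycle_surplus_ge W x n : R1 - x <= cycle_surplus W x n.
Proof.
by rewrite lerDl; apply: sumr_ge0 => k _; rewrite mulr_ge0 // excess_ge0.
Qed.

Lemma cycle_surplus_mono W x m n : (m <= n)%N ->
  cycle_surplus W x m <= cycle_surplus W x n.
Proof.
move=> /subnKC <-; rewrite lerD2l; apply: mean_le => k _.
by rewrite excess_split lerDl excess_ge0.
Qed.

Lemma cycle_surplus_lipschitz W x x' n : x <= x' ->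
  cycle_surplus W x n <= cycle_surplus W x' n + n.+1%:R * (x' - x).
Proof.
move=> xx'; rewrite /cycle_surplus.
have : \sum_k ps ord0 k * excess (x - W) k 1 n <=
       \sum_k ps ord0 k * (n%:R * (x' - x) + excess (x' - W) k 1 n).
  apply: mean_le => k _; rewrite [leRHS]addrC.
  have <- : x' - W - (x - W) = x' - x by lra.
  by apply: excess_lipschitz; rewrite lerD2r.
by rewrite mean_affine -(addn1 n) natrD mulrDl mul1r; lra.
Qed.

Definition unbeatable (W : R) : set R :=
  [set x | forall n, cycle_surplus W x n <= 0].

Definition gain (W : R) : R := inf (unbeatable W).

Lemma unbeatable_lbound W : lbound (unbeatable W) R1.
Proof.
by move=> x /(_ 0%N)/(le_trans (cycle_surplus_ge _ _ _)); rewrite subr_le0.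
Qed.

Lemma unbeatable_nonempty W : unbeatable W !=set0.
Proof.
exists (R1 + Num.max 0 W) => n; rewrite /cycle_surplus.
have h1 : W <= Num.max 0 W by rewrite le_max lexx orbT.
have h2 : 0 <= Num.max 0 W by rewrite le_max lexx.
rewrite big1 => [|k _]; first lra.
by rewrite excess_eq0 ?mulr0 //; have := R0_le k (ltn0Sn 0); lra.
Qed.

Lemma gain_ge W : R1 <= gain W.
Proof. exact: lb_le_inf (unbeatable_nonempty W) (@unbeatable_lbound W). Qed.

(** The infimum that defines the gain is attained: for each n the set of
    prices x with cycle_surplus W x n <= 0 is closed, by the Lipschitz bound. *)
Lemma cycle_surplus_gain_le0 W n : cycle_surplus W (gain W) n <= 0.
Proof.
rewrite leNgt; apply/negP => S0.
have e0 : 0 < cycle_surplus W (gain W) n / n.+1%:R by rewrite divr_gt0.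
have [|x xW] := @inf_adherent R (unbeatable W) _ e0.
  by split; [exact: unbeatable_nonempty|exists R1; exact: unbeatable_lbound].
rewrite -/(gain W) -ltrBlDl ltr_pdivlMr // mulrC => ltx.
have gx : gain W <= x by apply: ge_inf => //; exists R1; exact: unbeatable_lbound.
by have := cycle_surplus_lipschitz W n gx; have := xW n; lra.
Qed.

(** When price and subsidy grow by the same amount, passive slots break even as
    before and the active slot becomes less attractive, so the raised price is
    still high enough. *)
Lemma gain_slope W W' : W <= W' -> gain W' - W' <= gain W - W.
Proof.
move=> WW'; suff : gain W' <= gain W + (W' - W) by lra.
apply: ge_inf => [|n]; first by exists R1; exact: unbeatable_lbound.
have := cycle_surplus_gain_le0 W n; rewrite /cycle_surplus.
rewrite (_ : gain W + (W' - W) - W' = gain W - W); lra.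
Qed.

(** Were the surplus negative at N, it would stay so at a slightly smaller
    price x at which passive slots after the N-th are still unprofitable.  Then
    no n makes the surplus at x positive, against the minimality of the gain. *)
Lemma cycle_surplus_gain_ge0 W N :
  (forall k, 0 < ps ord0 k -> R0 k N.+1 < gain W - W) ->
  forall n, (N <= n)%N -> 0 <= cycle_surplus W (gain W) n.
Proof.
move=> lt_gain n Nn; apply: le_trans (cycle_surplus_mono _ _ Nn).
rewrite leNgt; apply/negP => S0.
have [x [xg Sx ltx]] : exists x, [/\ x < gain W, cycle_surplus W x N < 0 &
    forall k, 0 < ps ord0 k -> R0 k N.+1 < x - W].
  near (gain W)^'- => x; exists x; split.
  - by near: x; exact: nbhs_left_lt.
  - have xg : x <= gain W by near: x; exact: nbhs_left_le.
    apply: le_lt_trans (cycle_surplus_lipschitz W N xg) _.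
    rewrite addrC -ltrBrDr sub0r mulrC -ltr_pdivlMr // ltrBlDr -ltrBlDl.
    near: x; apply: nbhs_left_gt.
    by rewrite ltrBlDr ltrDl divr_gt0 // oppr_gt0.
  - near: x; apply: filter_forall => k.
    have [k0|_] := boolP (0 < ps ord0 k); last exact: nearW.
    near=> x => _; rewrite ltrBrDr; near: x; apply: nbhs_left_gt.
    by have := lt_gain k k0; lra.
suff : gain W <= x by rewrite leNgt xg.
apply: ge_inf => [|m]; first by exists R1; exact: unbeatable_lbound.
have [mN|/ltnW/subnKC <-] := leqP m N.
  exact: le_trans (cycle_surplus_mono _ _ mN) (ltW Sx).
apply: le_trans (ltW Sx); rewrite lerD2l; apply: mean_le => k k0.
by rewrite excess_split (excess_eq0 _ _ (ltW (ltx k k0))) // addr0.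
Unshelve. all: by end_near. Qed.

(** * Total rewards against the gain *)

Lemma convex_combination_le (p a b c : R) : 0 <= p <= 1 ->
  a <= c -> b <= c -> p * a + (1 - p) * b <= c.
Proof. by move=> /andP[p0 p1] ac bc; nra. Qed.

(** An active slot earns R1 and leads to a fresh run, whose mean excess is at
    most gain W - R1 by cycle_surplus_gain_le0; a passive slot earns at most the
    first term of the excess on top of gain W. *)
Lemma total_reward_le W (pi : policy R K) : admissible pi ->
  forall T h s, total_reward ps R1 R0 W pi T h s <=
    T%:R * gain W + excess (gain W - W) s.1 s.2 T.
Proof.
move=> adm; elim=> [|T IH] h [j t] /=; first by rewrite mul0r add0r excess_ge0.
have TE : T.+1%:R * gain W = T%:R * gain W + gain W.
  by rewrite mulrSr mulrDl mul1r.
rewrite /reward /next_mean /= TE.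
apply: convex_combination_le; first exact: adm.
- have : \sum_k ps ord0 k *
        total_reward ps R1 R0 W pi T (rcons h (j, t, true)) (k, 1%N) <=
      \sum_k ps ord0 k * (T%:R * gain W + excess (gain W - W) k 1 T).
    by apply: mean_le => k _; exact: IH.
  rewrite mean_affine.
  have := cycle_surplus_gain_le0 W T; rewrite /cycle_surplus.
  by have := excess_ge0 (gain W - W) j t T.+1; lra.
- have := IH (rcons h (j, t, false)) (j, t.+1); rewrite /= excess_rec.
  suff : R0 j t - (gain W - W) <= Num.max 0 (R0 j t - (gain W - W)) by lra.
  by rewrite le_max lexx orbT.
Qed.

(** The threshold policy collects each nonnegative term of the excess exactly
    and activates only where no excess is left, so it loses against the bound of
    total_reward_le only at restarts: in an active slot with T slots to follow
    it loses - cycle_surplus W (gain W) T.  The function d is any bound on the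
    accumulated losses that is consistent with the transitions. *)
Lemma threshold_reward_ge W (Gamma : 'I_K -> option nat)
    (d : nat -> label K -> R) :
  (forall j t, (0 < t)%N ->
     within_threshold t (Gamma j) = (gain W - W <= R0 j t)) ->
  (forall s, 0 <= d 0%N s) ->
  (forall T j t, d T (j, t.+1) <= d T.+1 (j, t)) ->
  (forall T j t, ~~ within_threshold t (Gamma j) ->
     \sum_k ps ord0 k * d T (k, 1%N) - cycle_surplus W (gain W) T
       <= d T.+1 (j, t)) ->
  forall T h s, (0 < s.2)%N ->
    T%:R * gain W + excess (gain W - W) s.1 s.2 T - d T s <=
    total_reward ps R1 R0 W (threshold_policy R Gamma) T h s.
Proof.
move=> GammaE d0 dS dA; elim=> [|T IH] h [j t] /= t0.
  by rewrite mul0r add0r /excess addn0 big_geq // sub0r oppr_le0.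
rewrite {1 3}/threshold_policy /=.
have TE : T.+1%:R * gain W = T%:R * gain W + gain W.
  by rewrite mulrSr mulrDl mul1r.
rewrite TE /next_mean /reward.
have [within|above] := boolP (within_threshold t (Gamma j)).
- rewrite mul0r add0r subr0 mul1r excess_rec.
  have -> : Num.max 0 (R0 j t - (gain W - W)) = R0 j t - (gain W - W).
    by apply/max_idPr; rewrite subr_ge0 -GammaE.
  have := IH (rcons h (j, t, false)) (j, t.+1) isT; have := dS T j t.
  by rewrite /=; lra.
- rewrite mul1r subrr mul0r addr0 excess_eq0 //; last first.
    by move: above; rewrite GammaE // -ltNge => /ltW.
  have : \sum_k ps ord0 k * (T%:R * gain W +
        (excess (gain W - W) k 1 T - d T (k, 1%N))) <=
      \sum_k ps ord0 k * total_reward ps R1 R0 W (threshold_policy R Gamma) T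
        (rcons h (j, t, true)) (k, 1%N).
    by apply: mean_le => k _; rewrite addrA; exact: (IH _ (k, 1%N)).
  rewrite mean_affine.
  under [X in _ + X <= _]eq_bigr do rewrite mulrBr.
  rewrite sumrB; have := dA T j t above; rewrite /cycle_surplus; lra.
Qed.

(** Losses at restarts stop either because the process gets trapped in a run
    that is passive forever, or because the surplus is 0 over long horizons. *)
Lemma threshold_bounded_deficit W (Gamma : 'I_K -> option nat) :
  (forall j t, (0 < t)%N ->
     within_threshold t (Gamma j) = (gain W - W <= R0 j t)) ->
  exists C, forall T h s, (0 < s.2)%N ->
    T%:R * gain W + excess (gain W - W) s.1 s.2 T - C <=
    total_reward ps R1 R0 W (threshold_policy R Gamma) T h s.
Proof.
move=> GammaE; have c0 : 0 <= gain W - R1 by rewrite subr_ge0 gain_ge.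
have [[k0 q0 Gk0]|finite] :=
  pselect (exists2 k, 0 < ps ord0 k & Gamma k = None).
- set q := ps ord0 k0 in q0; set C := (gain W - R1) / q.
  have C0 : 0 <= C by rewrite divr_ge0 // ltW.
  (* C solves C = (gain W - R1) + (1 - q) * C: one restart, and then again the
     same loss unless the user lands in k0. *)
  pose d (T : nat) (s : label K) := if Gamma s.1 is Some _ then C else 0.
  have d_ge0 T s : 0 <= d T s by rewrite /d; case: (Gamma _).
  have d_le T s : d T s <= C by rewrite /d; case: (Gamma _).
  exists C => T h s s0.
  apply: le_trans (threshold_reward_ge (d := d) GammaE _ _ _ T h s0) => //.
    by rewrite lerD2l lerN2.
  move=> {s0 s h}T j t; rewrite {2}/d /=; case: (Gamma j) => // m _.
  have : \sum_k ps ord0 k * d T (k, 1%N) <= (1 - q) * C.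
    have -> : 1 - q = \sum_(k | k != k0) ps ord0 k.
      by rewrite -ps_sum (bigD1 k0) //= addrAC subrr add0r.
    rewrite (bigD1 k0) //= {1}/d /= Gk0 mulr0 add0r mulr_suml; apply: ler_sum => k _.
    exact: ler_wpM2l.
  have := cycle_surplus_ge W (gain W) T.
  have : q * C = gain W - R1 by rewrite mulrC divfK // gt_eqF.
  lra.
- pose N := \max_k odflt 0%N (Gamma k).
  have ltN k : 0 < ps ord0 k -> R0 k N.+1 < gain W - W.
    move=> k0; rewrite ltNge -GammaE //.
    have := @leq_bigmax _ (fun k => odflt 0%N (Gamma k)) k.
    case E: (Gamma k) => [m|]; last by case: finite; exists k.
    by rewrite /= -ltnNge ltnS.
  (* Only restarts with fewer than N slots to follow lose anything, and each
     of them loses at most gain W - R1. *)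
  pose d (T : nat) (s : label K) : R := (minn T N)%:R * (gain W - R1).
  exists (N%:R * (gain W - R1)) => T h s s0.
  apply: le_trans (threshold_reward_ge (d := d) GammaE _ _ _ T h s0) => //.
  + by rewrite lerD2l lerN2 ler_wpM2r // ler_nat geq_minr.
  + by move=> s'; rewrite /d min0n mul0r.
  + move=> {s0 s h}T j t; rewrite /d ler_wpM2r // ler_nat.
    by rewrite leq_min geq_minr andbT (leq_trans (geq_minl _ _)).
  + move=> {s0 s h}T j t _; rewrite /d -mulr_suml ps_sum mul1r.
    have [NT|TN] := leqP N T.
      rewrite (minn_idPr (leqW NT)).
      by have := cycle_surplus_gain_ge0 ltN NT; lra.
    rewrite (minn_idPl TN) -(addn1 T) natrD mulrDl mul1r.
    by have := cycle_surplus_ge W (gain W) T; lra.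
Qed.

Lemma threshold_exists (y : R) (j : 'I_K) :
  {g : option nat | forall t, (0 < t)%N -> within_threshold t g = (y <= R0 j t)}.
Proof.
have [ex|all_ge] := pselect (exists m, R0 j m.+1 < y); last first.
  exists None => -[//|t] _; apply/esym; rewrite leNgt; apply/negP => lt_y.
  by case: all_ge; exists t.
exists (Some (ex_minn ex)); case: ex_minnP => m my mmin [//|t] _ /=.
apply/idP/idP => [tm|yt].
  by rewrite leNgt; apply/negP => /mmin; rewrite leqNgt tm.
rewrite ltnNge; apply/negP => mt.
have := R0_dec j (ltn0Sn m) (mt : (m.+1 <= t.+1)%N).
by move/(le_trans yt); rewrite leNgt my.
Qed.

End Bandit.

(** * Indexability *)

Theorem proposition1 (R : realType) (K : nat) (hK : (1 <= K)%N)
    (P : 'M[R]_K) (hP : stochastic P)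
    (ps : 'rV[R]_K) (hps : steady_state P ps)
    (R1 : R) (R0 : 'I_K -> nat -> R)
    (hR0 : forall (j : 'I_K) (t : nat), (1 <= t)%N -> 0 <= R0 j t)
    (hi : forall (j : 'I_K) (t t' : nat), (1 <= t)%N -> (t <= t')%N ->
       max_prob P j t' <= max_prob P j t)
    (hii : forall (j : 'I_K) (t t' : nat), (1 <= t)%N -> (t <= t')%N ->
       R0 j t <= R1 /\ R0 j t' <= R0 j t) :
  exists Gamma : R -> 'I_K -> option nat,
    (forall W : R, optimal ps R1 R0 W (threshold_policy R (Gamma W))) /\
    (forall W W' : R, W < W' ->
       passive_set (Gamma W) `<=` passive_set (Gamma W')).
Proof.
have [ps0 ps1 _] := hps.
have R0_le j t : (0 < t)%N -> R0 j t <= R1.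
  by move=> t0; have [] := hii j t t t0 (leqnn t).
have R0_dec j t t' : (0 < t)%N -> (t <= t')%N -> R0 j t' <= R0 j t.
  by move=> t0 tt'; have [] := hii j t t' t0 tt'.
pose y W := gain ps R1 R0 W - W.
pose Gamma W j := sval (threshold_exists R0_dec (y W) j).
have GammaE W j t : (0 < t)%N ->
    within_threshold t (Gamma W j) = (y W <= R0 j t).
  by rewrite /Gamma; case: threshold_exists => /= g; exact.
exists Gamma; split=> [W|W W' /ltW WW' [j t] [/= t0]].
  split=> [h s|s s0 pi' adm].
    by rewrite /threshold_policy; case: ifP; rewrite !lexx ler01.
  have [C lower] := threshold_bounded_deficit ps0 ps1 R0_le R0_dec (GammaE W).
  apply: (@average_reward_le _ _ _ _ _ _ C) => T.
  have := lower T [::] s s0.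
  have := total_reward_le ps0 ps1 R0_le R0_dec W adm T [::] s.
  lra.
rewrite GammaE // => yt; split=> //=.
by rewrite GammaE // (le_trans _ yt) // (gain_slope ps0 ps1).
Qed.
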